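(* If $n \geq 19$ and $n \equiv 1 \pmod 6$, then $\mathscr{I}(C_n)$ is not Hamiltonian.
   Context: For a graph $G$, an $i$-set is an independent dominating set of minimum size. The $i$-graph $\mathscr{I}(G)$ has the $i$-sets of $G$ as vertices, with $X,Y$ adjacent if and only if there is an edge $xy\in E(G)$ with $x\in X$, $y \notin X$ and $Y=(X\setminus\{x\})\cup\{y\}$. $C_n$ is the cycle on $n$ vertices. *)

(* Defs.v *)
From HB Require Import structures.
From mathcomp Require Import all_boot.

Set Implicit Arguments.
Unset Strict Implicit.
Unset Printing Implicit Defensive.

Record sgraph := SGraph {
  vertex :> finType;
  adj : rel vertex;
  adj_sym : symmetric adj;
  adj_irr : irreflexive adj }.

Section IGraph.
Variable G : sgraph.

Definition independent (X : {set G}) : bool :=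
  [forall x in X, forall y in X, ~~ adj x y].

Definition dominating (X : {set G}) : bool :=
  [forall v, (v \in X) || [exists x in X, adj x v]].

Definition ind_dominating (X : {set G}) : bool :=
  independent X && dominating X.

Definition is_iset (X : {set G}) : bool :=
  ind_dominating X && [forall Y : {set G}, ind_dominating Y ==> (#|X| <= #|Y|)].

Definition iset := {X : {set G} | is_iset X}.

Definition igraph_adj : rel iset := fun X Y =>
  [exists x, exists y,
    [&& adj x y, x \in val X, y \notin val X
      & val Y == y |: (val X :\ x)]].

Lemma igraph_adj_sym : symmetric igraph_adj.
Proof.
suff imp X Y : igraph_adj X Y -> igraph_adj Y X.
  by move=> X Y; apply/idP/idP; apply: imp.
case/existsP=> x /existsP[y /and4P[xy xX yX /eqP YE]].
have neq_xy : x != y by apply: contraNneq yX => <-.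
apply/existsP; exists y; apply/existsP; exists x.
rewrite adj_sym xy YE !inE !eqxx (negbTE neq_xy) /=.
apply/eqP/setP => z; rewrite !inE.
by case: eqVneq => [->|_] //=; case: eqVneq => [->|_] //=; apply/negbTE.
Qed.

Lemma igraph_adj_irr : irreflexive igraph_adj.
Proof.
move=> X; apply/existsP => -[x /existsP[y /and4P[_ _ yX /eqP XE]]].
by case/negP: yX; rewrite XE !inE eqxx.
Qed.

Definition igraph : sgraph := SGraph igraph_adj_sym igraph_adj_irr.

End IGraph.

(* [ordS i] is [i + 1] modulo [n].  The test [i != j] only matters for [n = 1],
   where it removes the loop; the graph is the n-cycle for [3 <= n]. *)
Definition cycle_adj (n : nat) : rel 'I_n := fun i j =>
  (i != j) && ((j == ordS i) || (i == ordS j)).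

Lemma cycle_adj_sym n : symmetric (@cycle_adj n).
Proof. by move=> i j; rewrite /cycle_adj eq_sym orbC. Qed.

Lemma cycle_adj_irr n : irreflexive (@cycle_adj n).
Proof. by move=> i; rewrite /cycle_adj eqxx. Qed.

Definition cycle_graph (n : nat) : sgraph :=
  SGraph (@cycle_adj_sym n) (@cycle_adj_irr n).

(* [ucycle] alone accepts closed walks with at most two vertices, which are not
   cycles of a simple graph; hence the size condition. *)
Definition hamiltonian (G : sgraph) : Prop :=
  exists c : seq G,
    [/\ 3 <= size c, ucycle (@adj G) c & forall v : G, v \in c].

(* Main.v *)
(** For n = 3k + 1, the gaps between consecutive elements of an i-set of the
    n-cycle have length 2 or 3, and exactly two of them have length 2; a move
    exchanges a gap of length 2 with an adjacent gap of length 3. If the two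
    gaps of length 2 are consecutive, the i-set has only two neighbours, in
    which one gap of length 3 separates the gaps of length 2, so a Hamiltonian
    cycle must use both edges. Conversely, an i-set with gaps 2, 3, 2 has two
    neighbours of the first kind, so its two edges of the Hamiltonian cycle are
    forced as well. Hence the cycle never leaves these two kinds of i-sets, and
    it misses any i-set with gaps 2, 3, 3, 2. *)

Require Import Defs.
From mathcomp Require Import all_boot.
From mathcomp Require Import zify.

(** * Hamiltonian cycles through vertices of degree at most two *)

Section ForcedCycle.
Variables (T : finType) (e : rel T) (c : seq T).
Hypotheses (e_sym : symmetric e) (c_ge3 : 3 <= size c) (c_cycle : ucycle e c).

(** Otherwise two steps along [c] would lead from [x] back to [x], which a duplicate-free cycle of
    length at least 3 excludes. *)
Lemma next_neq_prev x : x \in c -> next c x != prev c x.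
Proof.
case/andP: c_cycle => _ Uc xc; apply/eqP => /(congr1 (next c)).
rewrite next_prev //; case: (rot_to xc) => i c' Ec.
rewrite -!(next_rot i Uc) Ec; move: Uc c_ge3.
rewrite -(rot_uniq i) -(size_rot i) Ec.
case: c' {Ec} => [|y [|z c']] //=; rewrite !inE !negb_or eqxx.
case/and3P=> /and3P[xy xz _] _ _ _.
by rewrite eq_sym (negPf xy) eqxx => zx; rewrite zx eqxx in xz.
Qed.

Definition deg_le2 x := forall y1 y2 y3,
  e x y1 -> e x y2 -> e x y3 -> [|| y1 == y2, y1 == y3 | y2 == y3].

Lemma next_or_prev x y : x \in c -> deg_le2 x -> e x y ->
  y = next c x \/ y = prev c x.
Proof.
case/andP: (c_cycle) => cyc _ xc deg exy.
have epx : e x (prev c x) by rewrite e_sym (prev_cycle cyc xc).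
case/or3P: (deg _ _ _ exy (next_cycle cyc xc) epx) => /eqP; auto.
by move/eqP; rewrite (negPf (next_neq_prev _ xc)).
Qed.

Variables A B : pred T.
Hypothesis c_all : forall x, x \in c.
Hypothesis A_deg2 : forall x, A x -> deg_le2 x.
Hypothesis A_nbr : forall x y, A x -> e x y -> B y.
Hypothesis B_nbr : forall y, B y ->
  exists x1 x2, [/\ x1 != x2, A x1, A x2, e x1 y & e x2 y].

Lemma forced_cycle_cover x y : A x -> A y || B y.
Proof.
case/andP: (c_cycle) => cyc Uc Ax.
have nextAB z : A z || B z -> A (next c z) || B (next c z).
  case/orP=> [Az|/B_nbr[x1 [x2 [x12 A1 A2 e1 e2]]]].
    by rewrite (A_nbr _ _ Az (next_cycle cyc (c_all z))) orbT.
  case: (next_or_prev _ _ (c_all x1) (A_deg2 _ A1) e1) => Ez; last first.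
    by rewrite Ez next_prev // A1.
  case: (next_or_prev _ _ (c_all x2) (A_deg2 _ A2) e2) => Ez'; last first.
    by rewrite Ez' next_prev // A2.
  (* In the remaining case [z] is the successor of both [x1] and [x2], so these coincide. *)
  by rewrite -(prev_next Uc x1) -Ez Ez' prev_next // eqxx in x12.
(* [A] or [B] is preserved by [next c], and the orbit of [x] under [next c] is all of [c]. *)
have cxy : fconnect (next c) x y.
  by rewrite (fconnect_cycle (cycle_next Uc) (c_all x)) c_all.
rewrite -(iter_findex cxy); elim: (findex _ _ _) => [|k IHk] /=.
  by rewrite Ax.
exact: nextAB.
Qed.

End ForcedCycle.

(** * Moves in a cycle with rotation [s] and inverse [p], kept abstract so that both orientations
    are covered *)

Section Rotation.
Variables (n : nat) (s p : 'I_n -> 'I_n).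
Hypotheses (sK : cancel s p) (pK : cancel p s).
Hypothesis adjE : forall i j, cycle_adj i j = (j == s i) || (j == p i).
(** The gap patterns below reach from [v] to [iter 7 s v], hence the bound 8. *)
Hypothesis s_aperiodic : forall k v, 0 < k < 8 -> iter k s v != v.

Implicit Types (X Y : {set cycle_graph n}) (v w x y : 'I_n).

Lemma iter_s_eq j k v : j < 8 -> k < 8 -> (iter j s v == iter k s v) = (j == k).
Proof.
wlog le_jk : j k / j <= k => [hw j8 k8|j8 k8].
  case/orP: (leq_total j k) => /hw; first exact.
  by rewrite eq_sym [k == j]eq_sym; exact.
rewrite -(subnK le_jk) addnC iterD.
have iter_inj : injective (iter j s).
  elim: j {le_jk j8} => //= j IHj x y /(can_inj sK); exact: IHj.
rewrite (inj_eq iter_inj) eq_sym -{2}[j]addn0 eqn_add2l [0 == _]eq_sym.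
case: posnP => [->|k_gt0]; first by rewrite /= eqxx.
by apply/negbTE/s_aperiodic; lia.
Qed.

Lemma independent_s X x : independent X -> x \in X -> s x \notin X.
Proof.
move=> /forallP/(_ x)/implyP indX xX; apply/negP => sX.
move/forallP/(_ (s x))/implyP/(_ sX): (indX xX).
by rewrite /= adjE eqxx.
Qed.

Lemma independent_p X x : independent X -> x \in X -> p x \notin X.
Proof.
by move=> indX xX; apply/negP => /(independent_s _ _ indX); rewrite pK xX.
Qed.

Lemma independentI X : (forall x, x \in X -> s x \notin X) -> independent X.
Proof.
move=> indX; apply/forallP => x; apply/implyP => xX.
apply/forallP => y; apply/implyP => yX; rewrite /= adjE.
apply/negP => /orP[] /eqP Ey; first by have := indX _ xX; rewrite -Ey yX.
by have := indX _ yX; rewrite Ey pK xX.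
Qed.

Lemma dominatingP X :
  reflect (forall v, [|| p v \in X, v \in X | s v \in X]) (dominating X).
Proof.
apply: (iffP forallP) => domX v; have := domX v.
  case/orP=> [->|/existsP[x /andP[xX]]]; first by rewrite orbT.
  by rewrite /= adjE => /orP[] /eqP->; rewrite ?sK ?pK xX ?orbT.
case/or3P=> [pX|->|sX] //; apply/orP; right; apply/existsP.
  by exists (p v); rewrite pX /= adjE pK eqxx.
by exists (s v); rewrite sX /= adjE sK eqxx orbT.
Qed.

(* These are the vertices dominated twice, i.e. the middles of the gaps of
   length 2 between consecutive elements of an independent dominating set. *)
Definition dbl X : {set 'I_n} := [set v | (p v \in X) && (s v \in X)].

(* Count the incidences between the vertices and the closed neighbourhoods
   of the elements of [X]. *)
Lemma card_ind_dominating X : ind_dominating X -> 3 * #|X| = n + #|dbl X|.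
Proof.
case/andP=> indX /dominatingP domX.
have sumX (f : 'I_n -> 'I_n) : injective f -> \sum_v (f v \in X : nat) = #|X|.
  move=> f_inj; rewrite -(reindex_inj (P := xpredT) (F := fun v => v \in X : nat) f_inj).
  by rewrite -sum1_card [RHS]big_mkcond; apply: eq_bigr => v _; case: (v \in X).
have -> : 3 * #|X| = #|X| + #|X| + #|X| by lia.
rewrite -{1}(sumX _ (can_inj pK)) -{1}(sumX _ (@inj_id _)) -(sumX _ (can_inj sK)).
have -> : n + #|dbl X| = \sum_(v < n) 1 + #|dbl X| by rewrite sum1_card card_ord.
rewrite -[#|dbl X|]sum1_card [X in _ = _ + X]big_mkcond -!big_split /=; apply: eq_bigr => v _.
rewrite inE; have := domX v.
case pX: (p v \in X); case vX: (v \in X); case sX: (s v \in X) => //.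
- by have := independent_s _ _ indX vX; rewrite sX.
- by have := independent_p _ _ indX vX; rewrite pX.
- by have := independent_s _ _ indX vX; rewrite sX.
Qed.

(* The digits of [pat22] and [pat232] are the consecutive gap lengths in [X],
   read from [v] in the direction of [s]. *)
Definition pat22 X v := [&& v \in X, iter 2 s v \in X & iter 4 s v \in X].

Definition pat232 X v :=
  [&& v \in X, iter 2 s v \in X, iter 5 s v \in X & iter 7 s v \in X].

Lemma dbl_iter X k v : iter k s v \in X -> iter k.+2 s v \in X ->
  iter k.+1 s v \in dbl X.
Proof. by move=> Xk Xk2; rewrite inE /= sK Xk. Qed.

(** The middles of the two gaps are distinct elements of [dbl X], so they exhaust it. *)
Lemma pat22_dbl X v : #|dbl X| <= 2 -> pat22 X v ->
  dbl X = [set iter 1 s v; iter 3 s v].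
Proof.
move=> le2 /and3P[X0 X2 X4]; apply/esym/eqP.
rewrite eqEcard subUset !sub1set (dbl_iter _ 0) // (dbl_iter _ 2) //=.
by rewrite cards2 (iter_s_eq 1 3).
Qed.

(* When [x] moves to [s x], the vertex [p x] stays dominated only because
   [p (p x)] is in [X], so [x] is the right end of a gap of length 2. *)
Lemma move_s X x v : ind_dominating X -> #|dbl X| <= 2 -> pat22 X v ->
  ind_dominating (G := cycle_graph n) (s x |: X :\ x) -> x \in X -> x = iter 4 s v.
Proof.
move=> /andP[indX _] le2 Xv /andP[indY /dominatingP domY].
pose w := p (p x); have Ex : x = iter 2 s w by rewrite /= !pK.
clearbody w; subst x => X2.
have X1 : iter 1 s w \notin X.
  by have := independent_p _ _ indX X2; rewrite [iter 2 s w]/= sK.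
have X0 : w \in X.
  have := domY (iter 1 s w); rewrite /= sK -/(iter 1 s w) -/(iter 2 s w).
  rewrite -/(iter 3 s w) !inE (negPf X1) !andbF !iter_s_eq // eqxx !orbF.
  by rewrite (iter_s_eq 0 3) //= => /andP[].
have := dbl_iter _ 0 _ X0 X2; rewrite (pat22_dbl _ _ le2 Xv) !inE.
case/orP=> /eqP /= Ew; last by rewrite Ew.
(* Here [w = v]: the middle element of the pattern would move next to [iter 4 s v], which lies in
   [X]. *)
have: iter 4 s w \notin iter 3 s w |: X :\ iter 2 s w.
  by apply: independent_s; rewrite ?setU11.
case/and3P: Xv => _ _; rewrite /= -(can_inj sK Ew) => X4.
by rewrite !inE -/(iter 4 s w) -/(iter 2 s w) X4 !iter_s_eq // orbT.
Qed.

(** The gaps 2, 3, 2 become 2, 2, 3. *)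
Lemma move232 X v : ind_dominating X -> pat232 X v ->
  let Y : {set cycle_graph n} := iter 4 s v |: X :\ iter 5 s v in
  [/\ ind_dominating Y, #|Y| = #|X| & pat22 Y v].
Proof.
case/andP=> indX /dominatingP domX /and4P[X0 X2 X5 X7] Y.
have X3 : iter 3 s v \notin X := independent_s _ _ indX X2.
have X4 : iter 4 s v \notin X.
  by have := independent_p _ _ indX X5; rewrite /= sK.
split.
- apply/andP; split.
    apply: independentI => x; rewrite !inE.
    case/orP=> [/eqP->|/andP[x5 xX]].
      by rewrite negb_or -iterS eqxx iter_s_eq.
    rewrite (negPf (independent_s _ _ indX xX)) andbF orbF.
    by apply: contraNneq X3 => /(can_inj sK) Ex; rewrite -[iter 3 s v]Ex.
  apply/dominatingP => w; rewrite !inE.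
  (* Only the removed vertex and its two neighbours could lose their dominator; [iter 6 s v] is
     still dominated by [iter 7 s v]. *)
  have [->|w4] := eqVneq w (iter 4 s v); first by rewrite !orbT.
  have [->|w5] := eqVneq w (iter 5 s v); first by rewrite [iter 5 s v]/= sK eqxx.
  have [->|w6] := eqVneq w (iter 6 s v).
    by rewrite -iterS X7 !iter_s_eq // !orbT.
  rewrite /=; have := domX w.
  have -> : (p w == iter 5 s v) = false.
    by apply: contraNF w6 => /eqP/(congr1 s); rewrite pK => ->.
  have -> : (s w == iter 5 s v) = false.
    by apply: contraNF w4 => /eqP/(can_inj sK)/eqP.
  by case/or3P=> ->; rewrite ?orbT.
- by rewrite cardsU1 !inE (negPf X4) andbF [RHS](cardsD1 (iter 5 s v)) X5.
- rewrite /pat22 !inE eqxx X0 X2 !iter_s_eq //.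
  by rewrite (iter_s_eq 0 5) // !andbT !orbT.
Qed.

(** Both gaps of length 2 are used up by the pattern, so the next gap has length 3 and 2, 2, 3
    becomes 2, 3, 2. *)
Lemma move22 X v : ind_dominating X -> #|dbl X| <= 2 -> pat22 X v ->
  pat232 (iter 5 s v |: X :\ iter 4 s v) v.
Proof.
move=> /andP[indX /dominatingP domX] le2 Xv.
have Ed := pat22_dbl _ _ le2 Xv; case/and3P: Xv => X0 X2 X4.
have X5 : iter 5 s v \notin X := independent_s _ _ indX X4.
have X6 : iter 6 s v \notin X.
  by apply/negP => /(dbl_iter _ 4 _ X4); rewrite Ed !inE !iter_s_eq.
have X7 : iter 7 s v \in X.
  have := domX (iter 6 s v).
  by rewrite {1}[iter 6 s v]/= sK (negPf X6) (negPf X5).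
rewrite /pat232 !inE X0 X2 X7 eqxx.
by rewrite !iter_s_eq // (iter_s_eq 0 4) // !orbT.
Qed.

Lemma iter_sK k : cancel (iter k s) (iter k p).
Proof. by elim: k => // k IHk v; rewrite iterSr /= sK IHk. Qed.

Lemma iter_sB j k v : j <= k -> iter j p (iter k s v) = iter (k - j) s v.
Proof. by move=> le_jk; rewrite -{1}(subnKC le_jk) iterD iter_sK. Qed.

(** The clause [iter 5 s v \notin val Y] serves to tell apart the neighbours obtained in the two
    orientations. *)
Lemma move232_iset (X : iset (cycle_graph n)) v : pat232 (val X) v ->
  exists Y : iset (cycle_graph n),
    [/\ igraph_adj X Y, iter 5 s v \notin val Y & pat22 (val Y) v].
Proof.
move=> Xv; have /andP[idX /forallP minX] := valP X.
have [idY cardY Yv] := move232 _ _ idX Xv.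
set Y := iter 4 s v |: val X :\ iter 5 s v in idY cardY Yv.
have isY : is_iset (G := cycle_graph n) Y.
  rewrite /is_iset idY; apply/forallP => Z; rewrite cardY; exact: minX.
exists (Sub Y isY); split; last by rewrite SubK.
  case/and4P: Xv => _ _ X5 _; case/andP: idX => indX _.
  have := independent_p _ _ indX X5; rewrite [iter 5 s v]/= sK => X4.
  apply/existsP; exists (iter 5 s v); apply/existsP; exists (iter 4 s v).
  by rewrite SubK X5 /= adjE sK eqxx orbT X4 /=.
by rewrite SubK !inE eqxx orbF iter_s_eq.
Qed.

End Rotation.

Arguments pat22 {n} s X v.
Arguments pat232 {n} s X v.

(** * Reversal of orientation: both patterns are palindromes, read backwards from their last
    element *)

Section Flip.
Variables (n : nat) (s p : 'I_n -> 'I_n) (X : {set cycle_graph n}) (v : 'I_n).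
Hypothesis sK : cancel s p.

Lemma dblC : dbl n s p X = dbl n p s X.
Proof. by apply/setP => w; rewrite !inE andbC. Qed.

Lemma pat22_flip : pat22 s X v -> pat22 p X (iter 4 s v).
Proof.
by case/and3P=> X0 X2 X4; rewrite /pat22 !(iter_sB _ _ _ sK) // X0 X2 X4.
Qed.

Lemma pat232_flip : pat232 s X v -> pat232 p X (iter 7 s v).
Proof.
case/and4P=> X0 X2 X5 X7.
by rewrite /pat232 !(iter_sB _ _ _ sK) // X0 X2 X5 X7.
Qed.

End Flip.

(** * The i-sets of the n-cycle and their neighbours *)

Section Cycle.
Variable n : nat.
Hypotheses (n_ge19 : 19 <= n) (n_mod3 : n %% 3 = 1).

Implicit Types (X Y : {set cycle_graph n}) (v x : 'I_n).

Lemma val_ordS v : val (ordS v) = if v.+1 < n then v.+1 else 0.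
Proof.
have lt_vn := ltn_ord v; rewrite /=; case: ltnP => [/modn_small //|le_nv].
by rewrite (_ : v.+1 = n) ?modnn //; lia.
Qed.

Lemma val_ord_pred v : val (ord_pred v) = if 0 < v then v.-1 else n.-1.
Proof.
have lt_vn := ltn_ord v; rewrite /=; case: posnP => [->|v_gt0].
  by rewrite add0n modn_small; lia.
by rewrite (_ : (v + n).-1 = v.-1 + n) ?modnDr ?modn_small; lia.
Qed.

Lemma val_iter_ordS k v : v + k < n -> val (iter k (@ordS n) v) = v + k.
Proof.
elim: k => [|k IHk] vk_n; first by rewrite addn0.
have -> : val (iter k.+1 (@ordS n) v) = val (ordS (iter k (@ordS n) v)) by [].
by rewrite val_ordS (IHk _ : nat_of_ord _ = _) ?addnS ?ifT //; lia.
Qed.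

Lemma ordS_aperiodic k v : 0 < k < 8 -> iter k (@ordS n) v != v.
Proof.
move=> k8; have eq_iter : val (iter k (@ordS n) v) = (v + k) %% n.
  elim: k {k8} => [|k IHk]; first by rewrite addn0 modn_small.
  by rewrite [LHS]/= -addn1 [val _]IHk modnDml addn1 addnS.
apply/eqP => /(congr1 val); rewrite eq_iter => Ev.
have: v + k == v + 0 %[mod n] by rewrite Ev addn0 modn_small.
by rewrite eqn_modDl mod0n modn_small; lia.
Qed.

Lemma ord_pred_aperiodic k v : 0 < k < 8 -> iter k (@ord_pred n) v != v.
Proof.
move=> /(ordS_aperiodic _ v); apply: contraNneq => Ev.
by rewrite -{1}Ev (iter_sK _ _ _ (@ord_predK n)).
Qed.

Lemma adj_ordS v x : cycle_adj v x = (x == ordS v) || (x == ord_pred v).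
Proof.
rewrite /cycle_adj -[x == ord_pred v](inj_eq (@ordS_inj n)) ord_predK [ordS x == v]eq_sym.
case: eqVneq => [->|] //=; have := ordS_aperiodic 1 x isT.
by rewrite [x == _]eq_sym => /negPf /= ->.
Qed.

Lemma adj_ord_pred v x : cycle_adj v x = (x == ord_pred v) || (x == ordS v).
Proof. by rewrite adj_ordS orbC. Qed.

Let S := @ordS n.
Let P := @ord_pred n.

(* The gaps of [gap_set p] start with one 2, then [p %/ 3] times 3, then one 2,
   then only 3. *)
Definition gap_set (p : nat) : {set cycle_graph n} :=
  [set x : 'I_n |
    [|| x == 0 :> nat, (x <= p) && (x %% 3 == 2) | (p < x) && (x %% 3 == 1)]].

Lemma gap_set_ind_dominating p : p %% 3 = 2 -> p < n - 4 ->
  ind_dominating (gap_set p).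
Proof.
move=> p2 p_n; apply/andP; split.
  apply: (independentI _ _ _ (@ord_predK n) adj_ordS) => x.
  have := ltn_ord x; rewrite !inE val_ordS; case: ifP; lia.
apply/(dominatingP _ _ _ (@ordSK n) (@ord_predK n) adj_ordS) => x.
have := ltn_ord x; rewrite !inE val_ordS val_ord_pred; do 2![case: ifP]; lia.
Qed.

Lemma mem_dbl_gap_set p v : p %% 3 = 2 -> p < n - 4 ->
  (v \in dbl n S P (gap_set p)) = (v == 1 :> nat) || (v == p.+1 :> nat).
Proof.
move=> p2 p_n; have := ltn_ord v.
rewrite !inE val_ordS val_ord_pred; do 2![case: ifP]; lia.
Qed.

Lemma card_gap_set p : p %% 3 = 2 -> p < n - 4 -> 3 * #|gap_set p| = n + 2.
Proof.
move=> p2 p_n.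
rewrite (card_ind_dominating _ _ _ (@ordSK n) (@ord_predK n) adj_ordS); last first.
  exact: gap_set_ind_dominating.
have lt1n : 1 < n by lia. have ltpn : p.+1 < n by lia.
rewrite (_ : dbl _ _ _ _ = [set Ordinal lt1n; Ordinal ltpn]).
  by rewrite cards2 -val_eqE /=; case: p p2 {p_n ltpn}.
by apply/setP => v; rewrite mem_dbl_gap_set // !inE -!val_eqE.
Qed.

(** By [card_ind_dominating] and [n %% 3 = 1], [#|dbl X|] is 2 modulo 3, hence at least 2;
    [gap_set 2] attains this bound. *)
Lemma is_isetE X : is_iset X = ind_dominating X && (3 * #|X| == n + 2).
Proof.
have card_eq := card_ind_dominating _ _ _ (@ordSK n) (@ord_predK n) adj_ordS.
apply/andP/andP => -[idX].
  move/forallP/(_ (gap_set 2)).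
  rewrite gap_set_ind_dominating ?(leq_ltn_trans _ n_ge19) //; last by lia.
  have := card_gap_set 2 erefl ltac:(lia); have := card_eq _ idX => /=.
  by split=> //; lia.
move=> /eqP cX; split=> //; apply/forallP => Y; apply/implyP => /card_eq; lia.
Qed.

Lemma card_dbl_iset (X : iset (cycle_graph n)) : #|dbl n S P (val X)| <= 2.
Proof.
have := valP X; rewrite is_isetE => /andP[idX /eqP cX].
have := card_ind_dominating _ _ _ (@ordSK n) (@ord_predK n) adj_ordS _ idX.
by rewrite /S /P; lia.
Qed.

(** A forward move must use the last element of the pattern by [move_s]; a backward move uses the
    first, by [move_s] in the reversed orientation. *)
Lemma igraph_nbr22 (X Y : iset (cycle_graph n)) v :
    pat22 S (val X) v -> igraph_adj X Y ->
  val Y = iter 5 S v |: val X :\ iter 4 S v \/ val Y = P v |: val X :\ v.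
Proof.
move=> Xv /existsP[x /existsP[y /and4P[xy xX _ /eqP EY]]].
have /andP[idX _] := valP X; have /andP[idY _] := valP Y.
rewrite EY in idY *.
move: xy; rewrite /= adj_ordS => /orP[] /eqP Ey; rewrite Ey in idY *.
  left; have -> := move_s _ _ _ (@ordSK n) (@ord_predK n) adj_ordS
    ordS_aperiodic _ _ _ idX (card_dbl_iset X) Xv idY xX; by [].
have dblX : #|dbl n P S (val X)| <= 2 by rewrite dblC card_dbl_iset.
right; have := move_s _ _ _ (@ord_predK n) (@ordSK n) adj_ord_pred
    ord_pred_aperiodic _ _ _ idX dblX (pat22_flip _ _ _ _ _ (@ordSK n) Xv) idY xX.
by rewrite (iter_sK _ _ _ (@ordSK n)) => ->.
Qed.

Definition has22 (X : iset (cycle_graph n)) := [exists v, pat22 S (val X) v].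
Definition has232 (X : iset (cycle_graph n)) := [exists v, pat232 S (val X) v].

Lemma has22_deg_le2 (X : iset (cycle_graph n)) : has22 X -> deg_le2 _ (@igraph_adj (cycle_graph n)) X.
Proof.
case/existsP=> v Xv Y1 Y2 Y3 /(igraph_nbr22 _ _ _ Xv) E1.
move=> /(igraph_nbr22 _ _ _ Xv) E2 /(igraph_nbr22 _ _ _ Xv) E3.
rewrite -!val_eqE.
by case: E1 => ->; case: E2 => ->; rewrite ?eqxx //; case: E3 => ->;
  rewrite eqxx ?orbT.
Qed.

Lemma has22_nbr (X Y : iset (cycle_graph n)) : has22 X -> igraph_adj X Y -> has232 Y.
Proof.
case/existsP=> v Xv XY; have /andP[idX _] := valP X.
have dblX : #|dbl n P S (val X)| <= 2 by rewrite dblC card_dbl_iset.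
case: (igraph_nbr22 _ _ _ Xv XY) => EY; apply/existsP.
  exists v; rewrite EY; apply: (move22 _ _ _ _ _ adj_ordS) => //.
- exact: ordSK.
- exact: ord_predK.
- exact: ordS_aperiodic.
- exact: card_dbl_iset.
have := move22 _ _ _ (@ord_predK n) (@ordSK n) adj_ord_pred
    ord_pred_aperiodic _ _ idX dblX (pat22_flip _ _ _ _ _ (@ordSK n) Xv).
rewrite (iter_sK _ _ _ (@ordSK n)) (iterD 1 4) (iter_sK _ _ _ (@ordSK n)) -EY.
by move=> /(pat232_flip _ _ _ _ _ (@ord_predK n)); exists (iter 7 P (iter 4 S v)).
Qed.

(** Either end of the gap of length 3 can move inward. *)
Lemma has232_nbr (Y : iset (cycle_graph n)) : has232 Y ->
  exists X1 X2 : iset (cycle_graph n),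
    [/\ X1 != X2, has22 X1, has22 X2, igraph_adj X1 Y & igraph_adj X2 Y].
Proof.
case/existsP=> v Yv.
have [X1 [YX1 _ /and3P[X1_0 X1_2 X1_4]]] := move232_iset _ _ _
  (@ordSK n) (@ord_predK n) adj_ordS ordS_aperiodic _ _ Yv.
have [X2 [YX2 + X2v]] := move232_iset _ _ _ (@ord_predK n) (@ordSK n)
  adj_ord_pred ord_pred_aperiodic _ _ (pat232_flip _ _ _ _ _ (@ordSK n) Yv).
rewrite (iter_sB _ _ _ (@ordSK n)) // => X2_2.
exists X1, X2; split; try by rewrite igraph_adj_sym.
(* [X1] still contains [iter 2 S v], the element moved away in [X2]. *)
- by apply: contraNneq X2_2 => <-.
- by apply/existsP; exists v; apply/and3P.
by apply/existsP; exists (iter 4 P (iter 7 S v)); exact: pat22_flip (@ord_predK n) _.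
Qed.

Lemma gap_set_iset p : p %% 3 = 2 -> p < n - 4 -> is_iset (gap_set p).
Proof.
by move=> p2 p_n; rewrite is_isetE gap_set_ind_dominating // card_gap_set // eqxx.
Qed.

Lemma not_hamiltonian_igraph : ~ hamiltonian (igraph (cycle_graph n)).
Proof.
case=> c [c_ge3 c_cyc c_all].
have lt2 : 2 < n - 4 by lia. have lt8 : 8 < n - 4 by lia.
(* [gap_set 2] starts with gaps 2, 2 and [gap_set 8] with 2, 3, 3, 2. *)
pose X : iset (cycle_graph n) := Sub (gap_set 2) (gap_set_iset 2 erefl lt2).
pose Z : iset (cycle_graph n) := Sub (gap_set 8) (gap_set_iset 8 erefl lt8).
have AX : has22 X.
  have n_gt0 : 0 < n by lia.
  apply/existsP; exists (Ordinal n_gt0); rewrite /pat22 SubK !inE.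
  by rewrite !(val_iter_ordS _ (Ordinal n_gt0)) //=; lia.
have dblZ k v : iter k S v \in val Z -> iter k.+2 S v \in val Z ->
    val (iter k.+1 S v) = 1 \/ val (iter k.+1 S v) = 9.
  move=> Zk Zk2; have := dbl_iter _ _ _ (@ordSK n) _ _ _ Zk Zk2.
  by rewrite mem_dbl_gap_set // => /orP[]/eqP; auto.
have := forced_cycle_cover _ _ _ (@igraph_adj_sym _) c_ge3 c_cyc has22 has232 c_all
  has22_deg_le2 has22_nbr has232_nbr X Z AX.
(* The middles 1 and 9 in [Z] are 8 apart one way and [n - 8 >= 11] the other, whereas the patterns
   require distance 2 or 5. *)
case/orP=> /existsP[v].
  case/and3P=> Z0 Z2 Z4; have := dblZ 2 v Z2 Z4; rewrite (iterD 2 1).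
  by case: (dblZ 0 v Z0 Z2) => Ev;
  rewrite val_iter_ordS [nat_of_ord _]Ev; lia.
case/and4P=> Z0 Z2 Z5 Z7; have := dblZ 5 v Z5 Z7; rewrite (iterD 5 1).
by case: (dblZ 0 v Z0 Z2) => Ev;
  rewrite val_iter_ordS [nat_of_ord _]Ev; lia.
Qed.

End Cycle.

Theorem mainTheorem4 (n : nat) (hn : 19 <= n) (hmod : n = 1 %[mod 6]) :
  ~ hamiltonian (igraph (cycle_graph n)).
Proof. by apply: not_hamiltonian_igraph; [exact: hn | lia]. Qed.
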